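(* Define the following six words of length $18$ over the alphabet $\{0,1,2\}$ (written as strings of letters): $$U_0=210201202120102012,\qquad V_0=210201021202102012,$$ $$U_1=021012010201210120,\qquad V_1=021012102010210120,$$ $$U_2=102120121012021201,\qquad V_2=102120210121021201.$$ Then $[[U_0,V_0],[U_1,V_1],[U_2,V_2]]$ is an $18$-Brinkhuis triple-pair.
   Context: A word is a finite sequence of letters; it is square-free if it cannot be written as a concatenation $a\,x\,x\,b$ with $a,b$ (possibly empty) words and $x$ a non-empty word. Let $k$ be a positive integer. A triple-pair $[[U_0,V_0],[U_1,V_1],[U_2,V_2]]$, where $U_0,V_0,U_1,V_1,U_2,V_2$ are words over the alphabet $\{0,1,2\}$ all of the same length $k$, is called a $k$-Brinkhuis triple-pair if the following two conditions hold: (1) For all $i,j\in\{0,1,2\}$ with $i\ne j$, all $X\in\{U_i,V_i\}$ and all $Y\in\{U_j,V_j\}$, the concatenation $XY$ (a word of length $2k$) is square-free. (These are $24$ words: $U_0U_1, U_0V_1,\dots,V_2V_1$.) (2) For every integer $r$ with $k/2\le r<k$, the $12$ words consisting of the heads (prefixes) of length $r$ and the tails (suffixes) of length $r$ of the six words $U_0,U_1,U_2,V_0,V_1,V_2$ are all distinct (that is, the six prefixes and six suffixes are pairwise distinct as words). *)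

(* Defs.v *)
From mathcomp Require Import all_boot.

Set Implicit Arguments.
Unset Strict Implicit.
Unset Printing Implicit Defensive.

Definition square_free (T : Type) (w : seq T) : Prop :=
  forall a x b : seq T, w = a ++ x ++ x ++ b -> x = [::].

Definition word := seq 'I_3.

(* The i-th entry is the pair [U_i, V_i]. *)
Definition triple_pair := 3.-tuple (word * word).

Definition pair_words (p : word * word) : seq word := [:: p.1; p.2].

(* U_0, U_1, U_2, V_0, V_1, V_2, with multiplicity *)
Definition all_words (P : triple_pair) : seq word :=
  [seq p.1 | p <- P] ++ [seq p.2 | p <- P].

Definition head_of (r : nat) (w : word) : word := take r w.

Definition tail_of (r : nat) (w : word) : word := drop (size w - r) w.

Definition heads_and_tails (r : nat) (P : triple_pair) : seq word :=
  [seq head_of r w | w <- all_words P] ++ [seq tail_of r w | w <- all_words P].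

(* The real inequality k/2 <= r is written k <= 2r, since k may be odd. *)
Record brinkhuis_triple_pair (k : nat) (P : triple_pair) : Prop := {
  brinkhuis_gt0 : 0 < k;
  brinkhuis_size : forall w : word, w \in all_words P -> size w = k;
  brinkhuis_square_free : forall (i j : 'I_3) (X Y : word), i != j ->
    X \in pair_words (tnth P i) -> Y \in pair_words (tnth P j) ->
    square_free (X ++ Y);
  brinkhuis_uniq : forall r : nat, k <= 2 * r -> r < k ->
    uniq (heads_and_tails r P)
}.

Definition l0 : 'I_3 := @Ordinal 3 0 isT.
Definition l1 : 'I_3 := @Ordinal 3 1 isT.
Definition l2 : 'I_3 := @Ordinal 3 2 isT.

Definition U0 : word :=
  [:: l2; l1; l0; l2; l0; l1; l2; l0; l2;
      l1; l2; l0; l1; l0; l2; l0; l1; l2].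

Definition V0 : word :=
  [:: l2; l1; l0; l2; l0; l1; l0; l2; l1;
      l2; l0; l2; l1; l0; l2; l0; l1; l2].

Definition U1 : word :=
  [:: l0; l2; l1; l0; l1; l2; l0; l1; l0;
      l2; l0; l1; l2; l1; l0; l1; l2; l0].

Definition V1 : word :=
  [:: l0; l2; l1; l0; l1; l2; l1; l0; l2;
      l0; l1; l0; l2; l1; l0; l1; l2; l0].

Definition U2 : word :=
  [:: l1; l0; l2; l1; l2; l0; l1; l2; l1;
      l0; l1; l2; l0; l2; l1; l2; l0; l1].

Definition V2 : word :=
  [:: l1; l0; l2; l1; l2; l0; l2; l1; l0;
      l1; l2; l1; l0; l2; l1; l2; l0; l1].

(* Main.v *)
Require Import Defs.
From mathcomp Require Import all_boot.

Set Implicit Arguments.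
Unset Strict Implicit.
Unset Printing Implicit Defensive.

(** Both conditions reduce to finite checks done by evaluation. A square in [w] is determined by its
    start and half-length, each bounded by [size w], so [square_freebP] settles the 24 words
    [X ++ Y] by testing all such pairs; and [r] takes only the values 9 to 17. *)

Definition square_at (T : eqType) (w : seq T) (i n : nat) : bool :=
  (i + n + n <= size w) && (take n (drop i w) == take n (drop (i + n) w)).

Definition square_freeb (T : eqType) (w : seq T) : bool :=
  all (fun i => all (fun n => ~~ square_at w i n) (iota 1 (size w)))
      (iota 0 (size w)).

Lemma square_at_cat (T : eqType) (a x b : seq T) :
  square_at (a ++ x ++ x ++ b) (size a) (size x).
Proof.
rewrite /square_at !size_cat !addnA leq_addr /=.
rewrite drop_size_cat // take_size_cat // addnC -drop_drop.
by rewrite drop_size_cat // drop_size_cat // take_size_cat.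
Qed.

(** A factor [x ++ x] with [x] non-empty starts at [size a < size w] and has
    [1 <= size x <= size w], so the scan reaches it. *)
Lemma square_freebP (T : eqType) (w : seq T) : square_freeb w -> square_free w.
Proof.
move=> /allP sfw a x b def_w; apply: size0nil; apply/eqP.
case: posnP => // x_gt0.
have le_w : size a + size x <= size w by rewrite def_w !size_cat addnA leq_addr.
have i_in : size a \in iota 0 (size w).
  by rewrite mem_iota (leq_trans _ le_w) // -[ltnLHS]addn0 ltn_add2l.
have n_in : size x \in iota 1 (size w).
  by rewrite mem_iota x_gt0 add1n ltnS (leq_trans (leq_addl _ _) le_w).
by move/allP/(_ _ n_in)/negP: (sfw _ i_in); rewrite def_w square_at_cat.
Qed.

Theorem mainTheorem2 :
  brinkhuis_triple_pair 18 [tuple (U0, V0); (U1, V1); (U2, V2)].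
Proof.
split=> //.
- by move=> w w_in; apply/eqP; apply: (allP (a := fun w => size w == 18)) w_in.
(* The hypothesis [i != j] leaves six index pairs, with four words each. The default [(U0, V0)] is
   never reached. *)
- case=> [[|[|[|//]]] lt_i] [[|[|[|//]]] lt_j] X Y //= _;
    rewrite !(tnth_nth (U0, V0)) !inE => /orP[]/eqP-> /orP[]/eqP->;
    by apply: square_freebP; vm_compute.
(* Here 18 is read as [2 * 9] by conversion, giving [9 <= r]; [iota 9 9] lists 9 to 17. *)
- move=> r; rewrite (@leq_pmul2l 2 9 r) // => r_ge9 r_lt18.
  suff /allP : all (fun s => uniq (heads_and_tails s
      [tuple (U0, V0); (U1, V1); (U2, V2)])) (iota 9 9).
    by apply; rewrite mem_iota r_ge9.
  by vm_compute.
Qed.
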